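(* Let $R$ be a Henselian discrete valuation ring with finite residue field $k$ such that $\operatorname{char} k>2$ and $|k|>3$. Then, for every $A\in\mathrm{SL}_2(R)$ there exist $x\in\mathrm{SL}_2(R)$ and $y\in\mathrm{SL}_2(R)$ such that $(x,y)=A$.
   Context: For elements $x,y$ of a group, $(x,y)=xyx^{-1}y^{-1}$ denotes the group commutator. *)

(* Defs.v *)
From HB Require Import structures.
From mathcomp Require Import all_boot all_order all_algebra.

Set Implicit Arguments.
Unset Strict Implicit.
Unset Printing Implicit Defensive.

Import GRing.Theory.
Local Open Scope ring_scope.

(* [idealr_closed] describes proper ideals only; the unit ideal is always
   principal, so nothing is lost. *)
Definition principal_ideal_domain (R : idomainType) : Prop :=
  forall I : {pred R}, idealr_closed I ->
    exists a : R, forall x : R, x \in I <-> exists c : R, x = c * a.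

Definition nonzero_prime_ideal (R : idomainType) (I : {pred R}) : Prop :=
  [/\ idealr_closed I, prime_idealr_closed I & exists2 x : R, x \in I & x != 0].

(* A principal ideal domain with exactly one nonzero prime ideal, m, which is
   then its maximal ideal. *)
Definition discrete_valuation_ring (R : idomainType) (m : {pred R}) : Prop :=
  [/\ principal_ideal_domain R, nonzero_prime_ideal m
    & forall I : {pred R}, nonzero_prime_ideal I -> I =i m].

(* res presents k as the residue field R / m: it is surjective with kernel m. *)
Definition residue_map (R : idomainType) (m : {pred R}) (k : fieldType)
    (res : {rmorphism R -> k}) : Prop :=
  (forall c : k, exists x : R, res x = c) /\
  (forall x : R, (res x == 0) = (x \in m)).

(* Simple roots in the residue field of monic polynomials over R lift to R. *)
Definition henselian (R : idomainType) (k : fieldType)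
    (res : {rmorphism R -> k}) : Prop :=
  forall (f : {poly R}) (a0 : k), f \is monic ->
    root (map_poly res f) a0 -> ~~ root (map_poly res f)^`() a0 ->
    exists2 a : R, root f a & res a = a0.

Definition SL (n : nat) (R : comUnitRingType) : {pred 'M[R]_n} :=
  [pred M | \det M == 1].
Arguments SL n R : clear implicits.

(* The convention is x y x^-1 y^-1, unlike the library's [~ x, y], which is
   x^-1 y^-1 x y.  [invmx] is the inverse of every matrix in [SL n R]. *)
Definition mxcommutator (n : nat) (R : comUnitRingType) (x y : 'M[R]_n) :
    'M[R]_n :=
  x *m y *m invmx x *m invmx y.

(* Main.v *)
Require Import Defs.
From HB Require Import structures.
From mathcomp Require Import all_boot all_order all_algebra.
From mathcomp Require Import boolp ring.

Set Implicit Arguments.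
Unset Strict Implicit.
Unset Printing Implicit Defensive.

Import GRing.Theory.
Local Open Scope ring_scope.

(* A matrix of SL_2 whose top left entry is 1 is a product L U of a lower and an
   upper unipotent matrix, and is a commutator as soon as some unit e has
   1 - e^2 invertible.  Divisibility in R is total, so by conjugating with
   elementary matrices one reaches this shape, unless A is congruent to -1 modulo
   m.  In that case choose y of trace t = 0 mod m such that z = A y has trace t as
   well; matrices conjugating y to z with determinant 1 are the solutions of a
   binary quadratic equation reducing to u^2 + v^2 = -1 over k, which is solved
   over R by fixing v and applying Hensel's lemma to u.  Totality of divisibility
   needs R to be local: otherwise an element outside m which is not a unit would
   start an infinite chain of proper divisors. *)

(** * Divisibility and units in principal ideal domains *)

Section Divisibility.

Variable R : idomainType.
Implicit Types (a b c x y g : R) (m : {pred R}).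

Definition divides a x := exists c, x = c * a.

Lemma dividesrr a : divides a a.
Proof. by exists 1; rewrite mul1r. Qed.

Lemma dividesr0 a : divides a 0.
Proof. by exists 0; rewrite mul0r. Qed.

Lemma divides_trans b a c : divides a b -> divides b c -> divides a c.
Proof. by move=> [u ->] [v ->]; exists (v * u); rewrite mulrA. Qed.

Lemma divides_lin a c x y : divides a x -> divides a y -> divides a (c * x + y).
Proof. by move=> [u ->] [v ->]; exists (c * u + v); rewrite mulrDl mulrA. Qed.

Lemma divides_lin2 a u v x y :
  divides a x -> divides a y -> divides a (u * x + v * y).
Proof.
move=> ax ay; apply: divides_lin => //.
by rewrite -[v * y]addr0; apply: divides_lin => //; apply: dividesr0.
Qed.

Lemma unit_divides1 x : divides x 1 -> x \is a GRing.unit.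
Proof. by move=> [c c1]; apply/unitrPr; exists c; rewrite mulrC. Qed.

(** Classical reflection turns [I] into a boolean predicate; the unit ideal is split off because
    [idealr_closed] excludes it. *)
Lemma pid_ideal_generator (I : R -> Prop) :
    principal_ideal_domain R -> I 0 ->
    (forall a u v, I u -> I v -> I (a * u + v)) ->
  exists a, forall x, I x <-> divides a x.
Proof.
move=> pid I0 Ilin; have [I1|nI1] := pselect (I 1).
  exists 1 => x; split=> _; first by exists x; rewrite mulr1.
  by rewrite -[x]mulr1 -[x * 1]addr0; apply: Ilin.
have [|a aP] := pid [pred x | `[<I x>]].
  split; first by rewrite inE; apply/asboolP.
    by rewrite inE; apply/asboolPn.
  move=> a u v; rewrite !inE => /asboolP Iu /asboolP Iv.
  by apply/asboolP/Ilin.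
exists a => x; apply: iff_trans (aP x); rewrite inE.
by split=> /asboolP.
Qed.

Lemma pid_bezout x y : principal_ideal_domain R ->
  exists g, [/\ divides g x, divides g y & exists u v, g = u * x + v * y].
Proof.
move=> pid.
pose I z := exists u v, z = u * x + v * y.
have [||g gP] := @pid_ideal_generator I pid.
- by exists 0, 0; ring.
- move=> c _ _ [u [v ->]] [u' [v' ->]].
  by exists (c * u + u'), (c * v + v'); ring.
exists g; split; last exact/gP/dividesrr.
  by apply/gP; exists 1, 0; ring.
by apply/gP; exists 0, 1; ring.
Qed.

(** The ideals generated by the [s n] increase, and a generator of their union already lies in one
    of them. *)
Lemma pid_no_divisor_chain (s : nat -> R) : principal_ideal_domain R ->
    (forall n, divides (s n.+1) (s n)) ->
  exists n, divides (s n) (s n.+1).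
Proof.
move=> pid ds.
have ds_le i j : (i <= j)%N -> divides (s j) (s i).
  move=> /subnKC <-; elim: (j - i)%N => [|d IH].
    by rewrite addn0; apply: dividesrr.
  by rewrite addnS; apply: divides_trans IH.
have [||g gP] := @pid_ideal_generator (fun x => exists n, divides (s n) x) pid.
- by exists 0; apply: dividesr0.
- move=> c u v [i iu] [j jv]; exists (maxn i j); apply: divides_lin.
    by apply: divides_trans iu; apply/ds_le/leq_maxl.
  by apply: divides_trans jv; apply/ds_le/leq_maxr.
have [n sng] : exists n, divides (s n) g by apply/gP/dividesrr.
exists n; apply: divides_trans sng _; apply/gP.
by exists n.+1; apply: dividesrr.
Qed.

(* If the ideal (x) were prime it would be m; so x divides some u * v but
   neither factor, and g = gcd(x, u) is a proper divisor of x. *)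
Lemma dvr_proper_divisor m x : discrete_valuation_ring m ->
    x \notin m -> x \isn't a GRing.unit ->
  exists g, [/\ g \notin m, g \isn't a GRing.unit, divides g x & ~ divides x g].
Proof.
move=> [pid [[m0 m1 mlin] mP mn0] muniq] xm xU; apply: contrapT => nog.
pose I := [pred y : R | `[<divides x y>]].
suff /muniq/(_ x) : nonzero_prime_ideal I.
  by rewrite (negPf xm) inE asboolT //; apply: dividesrr.
split; last first.
- exists x; first by rewrite inE; apply/asboolP/dividesrr.
  by apply: contraNneq xm => ->.
- move=> u v; rewrite !inE => /asboolP xuv; apply/orP.
  have [xu|nxu] := pselect (divides x u); first by left; apply/asboolP.
  have [xv|nxv] := pselect (divides x v); first by right; apply/asboolP.
  case: nog; have [g [gx gu [a [b gE]]]] := pid_bezout x u pid.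
  exists g; split=> //.
  + apply: contra xm => gm; case: gx => c ->.
    by rewrite -[c * g]addr0; apply: mlin.
  + apply/negP => gU; apply: nxv.
    have -> : v = (g^-1 * a * v) * x + (g^-1 * b) * (u * v).
      by rewrite -[LHS]mul1r -(mulVr gU) {2}gE; ring.
    by apply: divides_lin2 => //; apply: dividesrr.
  + by move=> xg; apply: nxu; apply: divides_trans gu.
- split; first by rewrite inE; apply/asboolP/dividesr0.
    by rewrite inE; apply/asboolPn => /unit_divides1; apply/negP.
  move=> a u v; rewrite !inE => /asboolP xu /asboolP xv.
  by apply/asboolP/divides_lin.
Qed.

Lemma dvr_unit m x : discrete_valuation_ring m ->
  x \notin m -> x \is a GRing.unit.
Proof.
move=> hR xm; apply: contrapT => /negP xU.
pose T := {y : R | y \notin m /\ y \isn't a GRing.unit}.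
have /choice[f fP] : forall y : T, exists g : T,
    divides (sval g) (sval y) /\ ~ divides (sval y) (sval g).
  move=> [y [ym yU]]; have [g [gm gU gy yg]] := dvr_proper_divisor hR ym yU.
  by exists (exist _ g (conj gm gU)).
pose t n := iter n f (exist _ x (conj xm xU)).
have [pid _ _] := hR.
have [n|n] := @pid_no_divisor_chain (fun n => sval (t n)) pid.
  by have [] := fP (t n).
by have [] := fP (t n).
Qed.

End Divisibility.

(** * Units and divisibility seen through the residue field *)

Section Residue.

Variables (R : idomainType) (m : {pred R}) (k : fieldType).
Variable res : {rmorphism R -> k}.
Hypotheses (hR : discrete_valuation_ring m) (hres : residue_map m res).

Lemma residue_unit (x : R) : res x != 0 -> x \is a GRing.unit.
Proof. by case: hres => _ ->; apply: dvr_unit hR. Qed.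

Lemma residue_lift (c : k) : exists x, res x = c.
Proof. by case: hres. Qed.

(** The cofactors of a gcd satisfy a Bezout relation with value 1, so they cannot both vanish in
    [k], and one of them is a unit. *)
Lemma dvr_divides_total (x y : R) :
  divides x y \/ exists2 s, x = s * y & res s = 0.
Proof.
have [pid _ _] := hR.
have [g [[a xE] [b yE] [u [v gE]]]] := pid_bezout x y pid.
have [g0|gN0] := eqVneq g 0.
  by left; rewrite yE g0 mulr0; apply: dividesr0.
have [ra0|raN0] := eqVneq (res a) 0; last first.
  by left; exists (b / a); rewrite xE yE mulrA divrK // residue_unit.
right; have uv1 : u * a + v * b = 1.
  by apply: (mulIf gN0); rewrite mul1r [RHS]gE xE yE; ring.
have bU : b \is a GRing.unit.
  apply: residue_unit; apply: contra_eq_neq uv1 => rb0.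
  have /eqP := oner_neq0 k; rewrite -(rmorph1 res); apply: contra_not_neq => <-.
  by rewrite rmorphD !rmorphM ra0 rb0 !mulr0 addr0.
exists (a / b); first by rewrite xE yE mulrA divrK.
by rewrite rmorphM ra0 mul0r.
Qed.

End Residue.

(** * Counting squares in finite fields *)

Section FiniteField.

Variable k : finFieldType.

Lemma exists_neq0_neq_sqr1 : (3 < #|k|)%N ->
  exists2 e : k, e != 0 & 1 - e ^+ 2 != 0.
Proof.
move=> k3; have [e eP] : exists e : k, e \notin [:: 0; 1; -1].
  apply/existsP; rewrite -negb_forall; apply: contraL k3 => /forallP kP.
  rewrite -leqNgt -[3%N]/(size [:: 0; 1; -1 : k]).
  apply: leq_trans (card_size _); apply: subset_leq_card.
  by apply/subsetP => x _.
move: eP; rewrite !inE !negb_or => /and3P[e0 e1 eN1].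
exists e => //; rewrite -[1](expr1n _ 2) subr_sqr mulf_neq0 //.
  by rewrite subr_eq0 eq_sym.
by rewrite addrC addr_eq0.
Qed.

(* Recording which of the two square roots of x ^+ 2 the element x is embeds k
   into squares * bool, and 0 leaves one value unused. *)
Lemma card_squares : (#|k| < (#|[set x ^+ 2 | x : k]|).*2)%N.
Proof.
pose r (y : k) := odflt 0 [pick w | w ^+ 2 == y].
pose f (x : k) := (x ^+ 2, x == r (x ^+ 2)).
have rP x : r (x ^+ 2) ^+ 2 = x ^+ 2.
  by rewrite /r; case: pickP => [w /eqP //|/(_ x)]; rewrite eqxx.
have f_inj : injective f.
  move=> x y [xy]; rewrite -xy => xyr.
  move/eqP: (xy); rewrite eqf_sqr => /orP[/eqP //|/eqP xNy].
  have /eqP := rP x; rewrite eqf_sqr => /orP[] /eqP rx; apply/eqP.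
    by move: xyr; rewrite rx eqxx eq_sym => <-.
  have xNyE : - x = y by rewrite xNy opprK.
  by move: xyr; rewrite rx xNyE eqxx.
set S := [set _ | _ : _]; rewrite -muln2 -card_bool.
rewrite -[#|{: bool}|]cardsT -cardsX.
rewrite -(card_imset _ f_inj).
apply: proper_card; apply/properP; split.
  apply/subsetP => _ /imsetP[x _ ->]; apply/setXP; split; last by rewrite inE.
  exact: imset_f.
exists (0, false).
  apply/setXP; rewrite inE; split=> //.
  by apply/imsetP; exists 0; rewrite ?expr0n.
apply/imsetP => -[x _ [] /esym/eqP]; rewrite expf_eq0 /= => /eqP ->.
have := rP 0; rewrite expr0n /= => /eqP; rewrite expf_eq0 /= => /eqP ->.
by rewrite eqxx.
Qed.

(** Squares and their reflections [c - x] each fill more than half of [k], so they meet. The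
    condition [u != 0] later makes a root simple. *)
Lemma sum_two_squares (c : k) : c != 0 ->
  exists2 u : k, u != 0 & exists v : k, u ^+ 2 + v ^+ 2 = c.
Proof.
pose S := [set x ^+ 2 | x : k]; pose T := [set c - x | x in S] => c0.
have [z] : exists z, z \in S :&: T.
  apply/set0Pn; rewrite -card_gt0; have := card_squares.
  have := cardsUI S T; rewrite (card_imset S (inj_comp (addrI c) oppr_inj)) -/S.
  rewrite addnn => <-; case: #|S :&: T| => // .
  by rewrite addn0 ltnNge max_card.
rewrite inE => /andP[/imsetP[u _ ->] /imsetP[_ /imsetP[v _ ->] /eqP]].
rewrite -subr_eq opprK => /eqP uv.
have [u0|] := eqVneq u 0; last by exists u => //; exists v.
exists v; last by exists u; rewrite addrC.
by apply: contraNneq c0 => v0; rewrite -uv u0 v0 expr0n addr0.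
Qed.

End FiniteField.

(** * Explicit commutators of 2 by 2 matrices *)

Section TwoByTwo.

Variable R : comUnitRingType.
Implicit Types (a b c d : R) (A P Q : 'M[R]_2).

Definition mx2 a b c d : 'M[R]_2 :=
  \matrix_(i, j) if i == 0 then (if j == 0 then a else b)
                 else (if j == 0 then c else d).

Lemma mx2_eta A : A = mx2 (A 0 0) (A 0 1) (A 1 0) (A 1 1).
Proof.
apply/matrixP => i j; rewrite mxE.
by case: i j => [[|[|//]] ?] [[|[|//]] ?] /=; congr (A _ _); apply: val_inj.
Qed.

Lemma mul_mx2 a b c d a' b' c' d' :
  mx2 a b c d *m mx2 a' b' c' d' =
  mx2 (a * a' + b * c') (a * b' + b * d') (c * a' + d * c') (c * b' + d * d').
Proof.
apply/matrixP => i j; rewrite !mxE !big_ord_recl big_ord0 !mxE /= addr0.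
by case: i j => [[|[|//]] ?] [[|[|//]] ?].
Qed.

Lemma det_mx2 a b c d : \det (mx2 a b c d) = a * d - b * c.
Proof.
rewrite (expand_det_row _ 0) !big_ord_recl big_ord0 /cofactor !det_mx11 !mxE /=.
by ring.
Qed.

Lemma mx2_1 : mx2 1 0 0 1 = 1%:M.
Proof.
by apply/matrixP => i j; rewrite !mxE; case: i j => [[|[|//]] ?] [[|[|//]] ?].
Qed.

(** Proves an equality modulo a known relation: [n] is the multiplier of that relation, and a ring
    identity remains. *)
Lemma eq_lincomb (n x y l r : R) : l = r -> x - y = n * (l - r) -> x = y.
Proof. by move=> ->; rewrite subrr mulr0 => /eqP; rewrite subr_eq0 => /eqP. Qed.

(** Stated without inverses, so that it can be checked entrywise by [ring]. *)
Definition SL_commutator A := exists x y : 'M[R]_2,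
  [/\ x \in SL 2 R, y \in SL 2 R & x *m y = A *m y *m x].

Lemma SL_commutatorP A : SL_commutator A ->
  exists x y : 'M[R]_2, [/\ x \in SL 2 R, y \in SL 2 R & mxcommutator x y = A].
Proof.
move=> [x [y [xS yS xyE]]]; exists x, y; split=> //.
have unitSL z : z \in SL 2 R -> z \in unitmx.
  by rewrite inE unitmxE => /eqP ->; apply: unitr1.
by rewrite /mxcommutator xyE !mulmxK ?unitSL.
Qed.

(** [P] may have any invertible determinant, which allows the coordinate swap, of determinant -1. *)
Lemma SL_commutator_conj P Q A : P *m Q = 1%:M ->
  SL_commutator (Q *m A *m P) -> SL_commutator A.
Proof.
move=> PQ [x [y [xS yS xyE]]]; have QP := mulmx1C PQ.
have detPQ z : \det (P *m z *m Q) = \det z.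
  by rewrite !det_mulmx mulrAC -det_mulmx PQ det1 mul1r.
have QPK z : z *m Q *m P = z by rewrite -mulmxA QP mulmx1.
exists (P *m x *m Q), (P *m y *m Q); rewrite !inE !detPQ; split=> //.
by rewrite !mulmxA !QPK -[P *m x *m y]mulmxA xyE !mulmxA PQ mul1mx.
Qed.

(* Such a matrix is L *m U with L, U unipotent, lower and upper triangular.
   The upper triangular y with diagonal (1/e, e) is chosen so that A *m y is
   lower triangular with the same diagonal; as 1 - e ^+ 2 is a unit, both are
   diagonalizable, and x is the resulting conjugator. *)
Lemma SL_commutator_unipotent_corner t g (e : R) :
    e \is a GRing.unit -> 1 - e ^+ 2 \is a GRing.unit ->
  SL_commutator (mx2 1 t g (1 + g * t)).
Proof.
move=> /mulrV; set i := e^-1 => ei; move=> /mulrV; set f := (_)^-1 => ef.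
pose h := t * e ^+ 2 * f; pose w := g * f.
exists (mx2 1 (- h) w (1 - h * w)), (mx2 i (- (t * e)) 0 e).
rewrite !inE !det_mx2; split.
- by apply/eqP; ring.
- by apply/eqP; rewrite -ei; ring.
(* [ih], [iw] and [iwh] carry the upper right, lower left and lower right entries of the commutator
   equation. *)
have ih : i * h = e * h + t * e.
  apply/eqP; rewrite -subr_eq0 /h; apply/eqP.
  have -> : i * (t * e ^+ 2 * f) - (e * (t * e ^+ 2 * f) + t * e) =
    t * e * f * (e * i - 1) + t * e * ((1 - e ^+ 2) * f - 1) by ring.
  by rewrite ei ef; ring.
have iw : i * w = e * w + i * g.
  apply/eqP; rewrite -subr_eq0 /w; apply/eqP.
  have -> : i * (g * f) - (e * (g * f) + i * g) =
    g * i * ((1 - e ^+ 2) * f - 1) + g * f * e * (e * i - 1) by ring.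
  by rewrite ei ef; ring.
have iwh : g * (i * h) = t * e * w.
  apply: (addIr (e * w * h)); transitivity ((e * w + i * g) * h); first by ring.
  by rewrite -iw; transitivity (w * (i * h)); [ring | rewrite ih; ring].
rewrite !mul_mx2; congr mx2.
- by ring.
- by transitivity (- (e * h + t * e)); [ring | rewrite -ih; ring].
- by transitivity (i * w); [ring | rewrite iw; ring].
- by transitivity (e - e * h * w - t * e * w); [ring | rewrite -iwh; ring].
Qed.

(** The conjugation subtracts [t * c = a - 1] from the top left entry, which becomes 1. *)
Lemma SL_commutator_dvd_lower t a b c d (e : R) :
    e \is a GRing.unit -> 1 - e ^+ 2 \is a GRing.unit ->
    a * d - b * c = 1 -> a - 1 = t * c ->
  SL_commutator (mx2 a b c d).
Proof.
move=> eU e2U detA at1.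
apply: (@SL_commutator_conj (mx2 1 t 0 1) (mx2 1 (- t) 0 1)).
  by rewrite mul_mx2 -mx2_1; congr mx2; ring.
have aE : a = t * c + 1 by rewrite -at1 subrK.
have -> : mx2 1 (- t) 0 1 *m mx2 a b c d *m mx2 1 t 0 1 =
    mx2 1 (t + b - t * d) c (1 + c * (t + b - t * d)).
  rewrite !mul_mx2 aE; congr mx2; try by ring.
  by apply: (eq_lincomb (n := 1) detA); rewrite aE; ring.
exact: SL_commutator_unipotent_corner eU e2U.
Qed.

Lemma SL_commutator_dvd_upper t a b c d (e : R) :
    e \is a GRing.unit -> 1 - e ^+ 2 \is a GRing.unit ->
    a * d - b * c = 1 -> d - 1 = t * b ->
  SL_commutator (mx2 a b c d).
Proof.
move=> eU e2U detA dt1.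
apply: (@SL_commutator_conj (mx2 0 1 1 0) (mx2 0 1 1 0)).
  by rewrite mul_mx2 -mx2_1; congr mx2; ring.
rewrite !mul_mx2 !(mul0r, mulr0, mul1r, mulr1, add0r, addr0).
apply: SL_commutator_dvd_lower eU e2U _ dt1; rewrite -detA; ring.
Qed.

(* For y the companion matrix of trace t and z = A y, also of trace t, every x
   with columns w, - z w satisfies x y = z x; the last hypothesis on w = (u, v)
   says det x = 1. *)
Lemma SL_commutator_norm_form t a b c d u v :
    a * d - b * c = 1 -> t * (d - 1) = b - c ->
    d * u ^+ 2 - (c + d * t + b) * u * v + (a + b * t) * v ^+ 2 = 1 ->
  SL_commutator (mx2 a b c d).
Proof.
move=> detA tE uvE.
pose x1 := b * u - (a + b * t) * v; pose x2 := d * u - (c + d * t) * v.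
exists (mx2 u x1 v x2), (mx2 0 1 (- 1) t); rewrite !inE !det_mx2; split.
- by apply/eqP; rewrite -uvE /x1 /x2; ring.
- by apply/eqP; ring.
(* [tE] says that z has trace t. As det z = 1, Cayley-Hamilton gives z^2 = t z - 1, which is the
   second column of [x y = z x]. *)
have cE : c = b - t * (d - 1) by rewrite tE; ring.
rewrite !mul_mx2 /x1 /x2; congr mx2; try by ring.
- by apply: (eq_lincomb (n := - u) detA); rewrite cE; ring.
- by apply: (eq_lincomb (n := - v) detA); rewrite cE; ring.
Qed.

End TwoByTwo.

Lemma henselian_monic_quadratic (R : idomainType) (k : fieldType)
    (res : {rmorphism R -> k}) (b c : R) (a0 : k) : henselian res ->
    a0 ^+ 2 + res b * a0 + res c = 0 -> a0 *+ 2 + res b != 0 ->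
  exists2 a, a ^+ 2 + b * a + c = 0 & res a = a0.
Proof.
move=> hH a0root a0simple; pose f := 'X^2 + (b *: 'X + c%:P).
have mapf : map_poly res f = 'X^2 + (res b *: 'X + (res c)%:P).
  by rewrite !rmorphD /= map_polyXn map_polyZ map_polyX map_polyC.
have [|||a /rootP fa <-] := hH f a0; last 1 first.
- by exists a => //; rewrite -fa !hornerE ?addrA.
- rewrite monicE lead_coefDl ?lead_coefXn // size_polyXn.
  rewrite (leq_ltn_trans (size_polyD _ _)) // gtn_max.
  rewrite (leq_ltn_trans (size_scale_leq _ _)) ?size_polyX //.
  by rewrite (leq_ltn_trans (size_polyC_leq1 _)).
- by apply/rootP; rewrite mapf !hornerE ?addrA.
- rewrite mapf /root !derivD derivXn derivZ derivX derivC addr0.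
  by rewrite !(hornerD, hornerMn, hornerXn, hornerZ, hornerC) expr1 mulr1.
Qed.

(** * Commutators over the Henselian ring *)

Section SLtwo.
Variables (R : idomainType) (m : {pred R}) (k : finFieldType).
Variable res : {rmorphism R -> k}.
Hypotheses (hR : discrete_valuation_ring m) (hres : residue_map m res).
Hypothesis hH : henselian res.
Hypothesis k2 : 2%:R != 0 :> k.
Let resU := residue_unit hR hres.

Lemma SL_commutator_residue_N1 a b c d : a * d - b * c = 1 ->
    res a = - 1 -> res b = 0 -> res c = 0 -> res d = - 1 ->
  SL_commutator (mx2 a b c d).
Proof.
move=> detA ra rb rc rd.
have dU : d \is a GRing.unit by rewrite resU // rd oppr_eq0 oner_neq0.
have d1U : d - 1 \is a GRing.unit.
  by rewrite resU // rmorphB rmorph1 rd -opprD oppr_eq0.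
(* This value equalizes the traces of y and A y; [d - 1] reduces to -2, hence is a unit. *)
pose t := (b - c) / (d - 1).
have rt : res t = 0 by rewrite rmorphM rmorphB rb rc subrr mul0r.
have tE : t * (d - 1) = b - c by rewrite divrK.
clearbody t.
have rdiv x : res (x / d) = - res x.
  by rewrite -[X in - res X](divrK dU) [in RHS]rmorphM rd mulrN1 opprK.
have N1 : - 1 != 0 :> k by rewrite oppr_eq0 oner_neq0.
have [u0 u0N0 [v0 uv0]] := sum_two_squares N1.
have [v rv] := residue_lift hres v0.
(* The norm form equation divided by [d], as a monic quadratic in [u]. Modulo m its linear term
   vanishes, so its derivative at [u0] is [2 u0]. *)
have [||u uE ru] := @henselian_monic_quadratic R k res
    (- (c + d * t + b) * v / d) (((a + b * t) * v ^+ 2 - 1) / d) u0 hH.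
- rewrite !rdiv rmorphB rmorph1 !rmorphM rmorphN !rmorphD !rmorphM.
  by rewrite ra rb rc rt rv; apply: (eq_lincomb (n := 1) uv0); ring.
- rewrite rdiv rmorphM rmorphN !rmorphD rmorphM rb rc rt.
  by rewrite mulr0 !addr0 oppr0 mul0r oppr0 addr0 -mulr_natr mulf_neq0.
apply: (@SL_commutator_norm_form R t a b c d u v) => //.
have dE : d * d^-1 = 1 by rewrite mulrV.
apply: (eq_lincomb (n := d) uE).
pose q := (c + d * t + b) * v * u - (a + b * t) * v ^+ 2 + 1.
by apply: (eq_lincomb (n := q) dE); rewrite /q; ring.
Qed.

Lemma SL2_commutator (a b c d : R) : (3 < #|k|)%N -> a * d - b * c = 1 ->
  SL_commutator (mx2 a b c d).
Proof.
move=> k3 detA.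
have [e0 e0N0 e0N1] := exists_neq0_neq_sqr1 k3.
have [e re] := residue_lift hres e0.
have eU : e \is a GRing.unit by rewrite resU // re.
have e2U : 1 - e ^+ 2 \is a GRing.unit.
  by rewrite resU // rmorphB rmorph1 rmorphXn re.
have [[t tc]|[c' cE rc']] := dvr_divides_total hR hres c (a - 1).
  exact: SL_commutator_dvd_lower eU e2U detA tc.
have [[t tb]|[b' bE rb']] := dvr_divides_total hR hres b (d - 1).
  exact: SL_commutator_dvd_upper eU e2U detA tb.
(* Setting [a = 1] aside allows [a - 1] to be cancelled below. *)
have [a1|aN1] := eqVneq (a - 1) 0.
  apply: SL_commutator_dvd_lower eU e2U detA (_ : a - 1 = 0 * c).
  by rewrite a1 mul0r.
apply: (@SL_commutator_conj R (mx2 1 0 1 1) (mx2 1 0 (- 1) 1)).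
  by rewrite mul_mx2 -mx2_1; congr mx2; ring.
have -> : mx2 1 0 (- 1) 1 *m mx2 a b c d *m mx2 1 0 1 1 =
    mx2 (a + b) b (c + d - a - b) (d - b).
  by rewrite !mul_mx2; congr mx2; ring.
have detA' : (a + b) * (d - b) - b * (c + d - a - b) = 1 by rewrite -detA; ring.
have [[t tc]|[s sE rs]] :=
    dvr_divides_total hR hres (c + d - a - b) (a + b - 1).
  exact: SL_commutator_dvd_lower eU e2U detA' tc.
have rb : res b = 0 by rewrite bE rmorphM rb' mul0r.
have rc : res c = 0 by rewrite cE rmorphM rc' mul0r.
pose n := 1 - b' - s * b'.
have rn : res n = 1 by rewrite !rmorphB rmorphM rb' rs mulr0 !subr0 rmorph1.
have nU : n \is a GRing.unit by rewrite resU // rn oner_neq0.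
have rl : res (1 + s - c') = 1.
  by rewrite rmorphB rmorphD rmorph1 rs rc' addr0 subr0.
(* This is [sE] with [b] and [c] eliminated. Both cofactors reduce to 1, so [d - 1] and [a - 1] have
   equal residues. *)
have dn : (d - 1) * n = (a - 1) * (1 + s - c').
  have bE' : b = b' * d - b' by rewrite {1}bE; ring.
  have cE' : c = c' * a - c' by rewrite {1}cE; ring.
  apply: (eq_lincomb (n := 1) sE).
  have -> : n = 1 - b' - s * b' by [].
  rewrite bE' cE'.
  ring.
have rad : res (d - 1) = res (a - 1).
  have := congr1 res dn.
  by rewrite !rmorphM rn rl !mulr1.
(* This is n times (a - 1) + (d - 1) + (a - 1) * (d - 1) - b * c, which vanishes
   since det A = 1. *)
have /eqP : (a - 1) * (n + (1 + s - c') * (1 + (a - 1) * (1 - b' * c'))) = 0.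
  apply: (eq_lincomb (n := - (1 + (a - 1) * (1 - b' * c'))) dn).
  apply: (eq_lincomb (n := n) detA).
  by rewrite [b in RHS]bE [c in RHS]cE; ring.
rewrite mulf_eq0 (negPf aN1) /= => /eqP/(congr1 res).
rewrite rmorph0 rmorphD rn rmorphM rl rmorphD rmorph1.
rewrite rmorphM [res (1 - _)]rmorphB rmorph1 rmorphM rb' => radE.
have raE : res (a - 1) = res a - 1 by rewrite rmorphB rmorph1.
have ra : res a = - 1.
  by apply: (eq_lincomb (n := 1) radE); rewrite raE; ring.
have rd : res d = - 1.
  by rewrite -ra; apply: (addIr (- 1)); rewrite -raE -rad rmorphB rmorph1.
(* The goal is about the conjugated matrix, which also reduces to -1. *)
apply: SL_commutator_residue_N1 => //.
- by rewrite rmorphD ra rb addr0.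
- by rewrite !rmorphB rmorphD rc rd ra rb add0r subrr subr0.
- by rewrite rmorphB rd rb subr0.
Qed.

End SLtwo.

Theorem proposition6p2 (R : idomainType) (m : {pred R})
    (hR : discrete_valuation_ring m)
    (k : finFieldType) (res : {rmorphism R -> k}) (hres : residue_map m res)
    (hH : henselian res)
    (p : nat) (hp : p \in [pchar k]) (hp2 : (2 < p)%N) (hk : (3 < #|k|)%N)
    (A : 'M[R]_2) (hA : A \in SL 2 R) :
  exists x y : 'M[R]_2,
    [/\ x \in SL 2 R, y \in SL 2 R & mxcommutator x y = A].
Proof.
have k2 : 2%:R != 0 :> k.
  rewrite -(dvdn_pcharf hp); apply/negP => /(dvdn_leq (ltn0Sn 1)).
  by rewrite leqNgt hp2.
apply: SL_commutatorP; move: hA; rewrite inE [A]mx2_eta det_mx2 => /eqP.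
by move=> detA; apply: (SL2_commutator hR hres hH k2 _ detA).
Qed.
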